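(* Let $X$ be a complete metric space, $\Phi$ a local semiflow on $X$, $K$ a compact invariant set of $\Phi$ in $X$ and $\{M_1,\dots,M_n\}$ a Morse decomposition of $K$. Let $N\subset X$ be an ANE such that $K\subset N$. Then $$\mathrm{cat}_{N}(K)\leqslant\sum_{i=1}^n\mathrm{cat}_N(M_i).$$
   Context: Local semiflow: a continuous map $\Phi:\mathcal D(\Phi)\to X$, with $\mathcal D(\Phi)$ open in $\mathbb R^+\times X$ ($\mathbb R^+=[0,\infty)$), such that for each $x\in X$ there is $0<T_x\leqslant\infty$ with $(t,x)\in\mathcal D(\Phi)\iff 0\leqslant t<T_x$; $\Phi(0,x)=x$; and $\Phi(t+s,x)=\Phi(t,\Phi(s,x))$ whenever $(t+s,x)\in\mathcal D(\Phi)$, $t,s\geqslant 0$. Write $\Phi(t)x=\Phi(t,x)$. A set $K$ is invariant if $\Phi(t)K=K$ for all $t\geqslant0$ (with $T_x=\infty$ for $x\in K$). Morse decomposition: let $K$ be a compact invariant set. A set $M$ attracts a set $B$ if $T_x=\infty$ for all $x\in B$ and for each neighborhood $U$ of $M$ there is $T>0$ with $\Phi(t)B\subset U$ for all $t>T$. An attractor in $K$ is a nonempty compact invariant set $A\subset K$ which attracts (for the restricted semiflow $\Phi|_K$ on $K$) some neighborhood $U$ of $A$ in $K$ and is the maximal compact invariant set in $U$; $\Omega_K(A)$ is the set of $x\in K$ attracted by $A$ under $\Phi|_K$. The empty set is also allowed as $A_0$, with $\Omega_K(\emptyset)=\emptyset$. An ordered collection $\{M_1,\dots,M_n\}$ is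 a Morse decomposition of $K$ if there is a sequence $\emptyset=A_0\subsetneq A_1\subsetneq\cdots\subsetneq A_n=K$ of attractors in $K$ with $M_k=A_k\setminus\Omega_K(A_{k-1})$, $1\leqslant k\leqslant n$. Category: let $Z$ be a topological space, $I=[0,1]$. A closed set $A\subset Z$ is contractible in $Z$ if there is a continuous $h:I\times A\to Z$ with $h(0,u)=u$ and $h(1,u)=h(1,v)$ for all $u,v\in A$. For closed $A\subset Z$, $\mathrm{cat}_Z(A)$ is the least $m\in\{0,1,2,\dots\}\cup\{\infty\}$ such that $A$ is a union of $m$ closed subsets of $Z$ each contractible in $Z$ ($\infty$ if no finite $m$ works; $\mathrm{cat}_Z(\emptyset)=0$). ANE: a metric space $Z$ is an absolute neighborhood extensor (ANE) if for every metric space $S$, every closed $F\subset S$ and every continuous $f:F\to Z$, there is a continuous extension of $f$ to a neighborhood of $F$ in $S$. Subsets of $X$ carry the induced metric. *)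

(* Defs.v *)
From HB Require Import structures.
From mathcomp Require Import all_boot all_order all_algebra.
From mathcomp Require Import all_classical all_reals all_analysis.

Set Implicit Arguments.
Unset Strict Implicit.
Unset Printing Implicit Defensive.

Import Order.TTheory GRing.Theory Num.Theory.
Import numFieldNormedType.Exports.

Local Open Scope classical_set_scope.
Local Open Scope ring_scope.

(* A subset of an ambient space [X] plays the role of a space in its own right
   (with the induced metric) through the library's [subspace] topology. *)
Section RelativeTopology.
Context {X : topologicalType}.
Implicit Types Z A U : set X.

Definition closed_in Z A : Prop :=
  A `<=` Z /\ closed (A : set (subspace Z)).

Definition nbhd_in Z A U : Prop :=
  U `<=` Z /\ @set_nbhs (subspace Z) A U.

End RelativeTopology.

(* The library's [completeType] also requires a distinguished point; this is
   its completeness axiom alone, so that the empty space is not excluded. *)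
Definition complete_space (X : uniformType) : Prop :=
  forall F : set_system X, ProperFilter F -> cauchy F -> exists x : X, F --> x.

Section LocalSemiflow.
Context {R : realType} {X : metricType R}.

Definition semiflow_domain (T : X -> \bar R) : set (R * X) :=
  [set p | 0 <= p.1 /\ (p.1%:E < T p.2)%E].

(* [flow] is a total function whose values outside the domain are irrelevant.
   The identity Phi(t+s,x) = Phi(t,Phi(s,x)) of a partial map includes the
   assertion that its right-hand side is defined. *)
Record local_semiflow := LocalSemiflow {
  flow :> R -> X -> X ;
  lifetime : X -> \bar R ;
  lifetime_gt0 : forall x, (0 < lifetime x)%E ;
  domain_open :
    open (semiflow_domain lifetime :
            set (subspace (`[0, +oo[%classic `*` [set: X] : set (R * X)))) ;
  flow_continuous :
    {within semiflow_domain lifetime,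
      continuous (fun p : R * X => flow p.1 p.2)} ;
  flow0 : forall x, flow 0 x = x ;
  flowD : forall t s x, 0 <= t -> 0 <= s -> ((t + s)%:E < lifetime x)%E ->
    (t%:E < lifetime (flow s x))%E /\ flow (t + s) x = flow t (flow s x)
}.

Implicit Types (Phi : local_semiflow) (K M A B Y : set X).

Definition invariant_set Phi K : Prop :=
  (forall x, K x -> lifetime Phi x = +oo%E) /\
  (forall t : R, 0 <= t -> Phi t @` K = K).

(* [Y] is the phase space: with [Y := K] invariant, this is attraction under
   the restriction of [Phi] to [K], neighborhoods being taken in [K]. *)
Definition attracts Phi Y M B : Prop :=
  (forall x, B x -> lifetime Phi x = +oo%E) /\
  (forall U, nbhd_in Y M U ->
    exists2 T : R, 0 < T & forall t, T < t -> Phi t @` B `<=` U).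

Definition is_attractor Phi K A : Prop :=
  [/\ A !=set0, compact A, invariant_set Phi A, A `<=` K &
      exists U, [/\ nbhd_in K A U, attracts Phi K A U &
        forall B, compact B -> invariant_set Phi B -> B `<=` U -> B `<=` A]].

(* For [A = set0] this is [set0]: the empty set is a neighborhood of itself,
   and it does not contain any point of an orbit. *)
Definition attraction_basin Phi K A : set X :=
  [set x | K x /\ attracts Phi K A [set x]].

(* [M k] for [k : 'I_n] is the (k+1)-st Morse set. *)
Definition morse_decomposition Phi K (n : nat) (M : 'I_n -> set X) : Prop :=
  exists A : nat -> set X,
    [/\ A 0%N = set0,
        A n = K,
        forall k, (k < n)%N -> A k `<` A k.+1,
        forall k, (0 < k <= n)%N -> is_attractor Phi K (A k) &
        forall k : 'I_n, M k = A k.+1 `\` attraction_basin Phi K (A k)].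

End LocalSemiflow.
Arguments local_semiflow {R} X.

Section Category.
Context {R : realType} {X : metricType R}.
Implicit Types Z A : set X.

Definition contractible_in Z A : Prop :=
  exists h : R * X -> X,
    [/\ {within `[0, 1]%classic `*` A, continuous h},
        forall t u, `[0, 1]%classic t -> A u -> Z (h (t, u)),
        forall u, A u -> h (0, u) = u &
        forall u v, A u -> A v -> h (1, u) = h (1, v)].

Definition categorical_cover Z A (m : nat) : Prop :=
  exists C : 'I_m -> set X,
    (forall i, closed_in Z (C i) /\ contractible_in Z (C i)) /\
    A = \bigcup_i C i.

(* The infimum of a set of naturals: its least element, or [+oo] if empty. *)
Definition ls_category Z A : \bar R :=
  ereal_inf [set m%:R%:E | m in [set m : nat | categorical_cover Z A m]].

End Category.

(* The maps are total but only constrained on [F], resp. [U]; a continuous map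
   into the subspace [Z] is one into [X] with values in [Z]. *)
Definition ANE (R : realType) (X : metricType R) (Z : set X) : Prop :=
  forall (S : metricType R) (F : set S) (f : S -> X),
    closed F -> {within F, continuous f} -> f @` F `<=` Z ->
    exists (U : set S) (g : S -> X),
      [/\ set_nbhs F U, {within U, continuous g}, g @` U `<=` Z &
          forall x, F x -> g x = f x].

(* Main.v *)
(* It suffices to show cat B <= cat A + cat (B \ basin A) for consecutive
   attractors A `<=` B and to sum. By the ANE property the contractible pieces
   covering A and B \ basin A can be thickened in K. The points of B outside an
   open set covered by the second family form a compact subset of the basin of
   A, so one time t moves all of them into the first family; the preimages of
   its members under Phi t are contractible in N: follow the flow up to time t,
   then contract. *)
Require Import Defs.
From HB Require Import structures.
From mathcomp Require Import all_boot all_order all_algebra.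
From mathcomp Require Import all_classical all_reals all_analysis.
From mathcomp Require Import lra.

Set Implicit Arguments.
Unset Strict Implicit.
Unset Printing Implicit Defensive.

Import Order.TTheory GRing.Theory Num.Theory.
Import numFieldNormedType.Exports.
Local Open Scope classical_set_scope.
Local Open Scope ring_scope.

(** * The maximum metric on a product *)

Section ProductMetric.
Context {R : realType} {U V : metricType R}.
Implicit Types x y : U * V.

(** [ANE] quantifies over metric spaces only, and it will be applied to a product of the time axis
    with [X]. The maximum is chosen because its balls are those of the product structure. *)
Definition prod_mdist x y : R := Num.max (mdist x.1 y.1) (mdist x.2 y.2).

Lemma prod_mdist_ge0 x y : 0 <= prod_mdist x y.
Proof. by rewrite le_max mdist_ge0. Qed.

Lemma prod_mdist_positivity x y : prod_mdist x y = 0 -> x = y.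
Proof.
move=> /eqP; rewrite eq_le ge_max => /andP[/andP[d1 d2] _].
rewrite [x]surjective_pairing [y]surjective_pairing.
by congr pair; apply: mdist_positivity; apply/eqP; rewrite eq_le mdist_ge0 andbT.
Qed.

Lemma ballE_prod_mdist x (d : R) : ball x d = [set y | prod_mdist x y < d].
Proof.
apply/seteqP; split=> y; rewrite /prod_mdist /= gt_max.
  by case; rewrite !ballEmdist /= => -> ->.
by move=> /andP[d1 d2]; split; rewrite ballEmdist.
Qed.

HB.instance Definition _ := @PseudoMetric_isMetric.Build R (U * V)%type
  prod_mdist prod_mdist_ge0 prod_mdist_positivity ballE_prod_mdist.

End ProductMetric.

(** * Continuity relative to a subset *)

Section WithinContinuity.
Context {S T U : topologicalType}.

Lemma within_continuous_comp (A : set S) (B : set T) (f : S -> T) (g : T -> U) :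
  (forall x, A x -> B (f x)) -> {within A, continuous f} ->
  {within B, continuous g} -> {within A, continuous (g \o f)}.
Proof.
move=> AB /subspace_continuousP fc /subspace_continuousP gc.
apply/subspace_continuousP => x Ax.
apply: cvg_comp (gc _ (AB _ Ax)) => W /(fc x Ax).
rewrite /nbhs/= /within/=; apply: filterS => y + Ay; apply => //; exact: AB.
Qed.

Lemma within_continuous_eq (A : set S) (f g : S -> T) :
  (forall x, A x -> f x = g x) -> {within A, continuous f} ->
  {within A, continuous g}.
Proof.
move=> fg; apply: subspace_eq_continuous => x; rewrite inE; exact: fg.
Qed.

Lemma within_continuous_pair (A : set S) (f : S -> T) (g : S -> U) :
  {within A, continuous f} -> {within A, continuous g} ->
  {within A, continuous (fun x => (f x, g x))}.
Proof. by move=> fc gc x; apply: cvg_pair; [exact: fc|exact: gc]. Qed.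

Lemma closed_prod (A : set S) (B : set T) :
  closed A -> closed B -> closed (A `*` B).
Proof.
move=> cA cB; rewrite (_ : A `*` B = fst @^-1` A `&` snd @^-1` B) //.
by apply: closedI; apply: preimage_closed => //= x _;
  [exact: cvg_fst|exact: cvg_snd].
Qed.

Lemma closed_preimage_within (A : set S) (B : set T) (f : S -> T) :
  closed A -> closed B -> {within A, continuous f} ->
  closed (A `&` f @^-1` B).
Proof.
move=> cA cB /continuous_closedP/(_ _ cB)/closed_subspaceP[V cV].
by rewrite setIC [X in closed X]setIC => <-; apply: closedI.
Qed.

End WithinContinuity.

(** * Thickening contractible sets and transporting contractibility along homotopies *)

Section Contractibility.
Context {R : realType} {X : metricType R}.
Implicit Types (N K A B C D : set X).

Lemma contractible_in_sub N A B :
  A `<=` B -> contractible_in N B -> contractible_in N A.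
Proof.
move=> AB [h [hc hN h0 h1]]; exists h; split.
- by apply: continuous_subspaceW hc => -[t x] [? /AB].
- by move=> t u t01 /AB; exact: hN.
- by move=> u /AB; exact: h0.
- by move=> u v /AB Bu /AB; exact: h1.
Qed.

Lemma contractible_in0 N : contractible_in N set0.
Proof.
by exists snd; split=> //; rewrite setX0; exact: continuous_subspace0.
Qed.

(* The contraction [h] is extended by the identity on [{0} x K] and by a
   constant on [{1} x K], then by the ANE property to a neighborhood of
   [`[0, 1] x C], hence to some [`[0, 1] x W] by compactness. *)
Lemma contractible_in_thickening N K C : ANE N -> compact K -> K `<=` N ->
  C `<=` K -> closed C -> contractible_in N C ->
  exists B, set_nbhs C B /\ contractible_in N (K `&` closure B).
Proof.
move=> hN cK KN CK cC [h [hc hhN h0 h1]].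
(* The endpoint [p] of the contraction is read off at a point of [C], so the empty piece is treated
   apart. *)
have [->|/set0P[u0 Cu0]] := eqVneq C set0.
  exists set0; split; first by move=> x.
  by rewrite closure0 setI0; exact: contractible_in0.
pose p := h (1, u0).
pose f (q : R^o * X) := if q.1 == 0 then q.2 else if q.1 == 1 then p else h q.
pose F : set (R^o * X) := ([set 0] `*` K `|` `[0, 1]%classic `*` C)
   `|` [set 1] `*` K.
have clK : closed K by apply: compact_closed => //; exact: metric_hausdorff.
have cF1 : closed ([set (0 : R^o)] `*` K) by apply: closed_prod.
have cF2 : closed ((`[0, 1]%classic : set R^o) `*` C).
  by apply: closed_prod => //; exact: interval_closed.
have cF3 : closed ([set (1 : R^o)] `*` K) by apply: closed_prod.
have cF : closed F by apply: closedU => //; exact: closedU.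
have fc : {within F, continuous f}.
  apply: withinU_continuous => //; first exact: closedU.
    apply: withinU_continuous => //.
    - apply: (within_continuous_eq (f := snd)).
        by move=> [t x] [/= -> _]; rewrite /f eqxx.
      by apply: continuous_subspaceT => x; exact: cvg_snd.
    (* The three pieces of [F] overlap at times 0 and 1; there [f] still agrees with [h] on [C],
       since [h] starts at the identity and ends at [p]. *)
    - apply: (within_continuous_eq (f := h)) => // -[t x] [/= _ Cx].
      rewrite /f /=; case: eqVneq => [->|_]; first exact: h0.
      by case: eqVneq => [->|_] //; exact: h1.
  apply: (within_continuous_eq (f := fun=> p)).
    by move=> [t x] [/= -> _]; rewrite /f /= oner_eq0 eqxx.
  by apply: continuous_subspaceT => x; exact: cvg_cst.
have pN : N p by apply: hhN => //; rewrite /= in_itv /= ler01 lexx.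
have fN : f @` F `<=` N.
  move=> _ [[t x] Ftx <-]; rewrite /f /=.
  case: eqVneq Ftx => [->|t0].
    by case=> [[]|] [_ /=]; [exact: KN|move=> /CK; exact: KN|exact: KN].
  case: eqVneq => // t1 [[]|] [/= tE]; [by rewrite tE eqxx in t0| |].
    exact: hhN.
  by rewrite tE eqxx in t1.
have [U [g [FU gc gN gf]]] := hN _ _ _ cF fc fN.
pose W : set X := [set x | (`[0, 1]%classic : set R) `<=` [set t | U (t, x)]].
have CW : set_nbhs C W.
  move=> x Cx.
  have /compact_near_coveringP nc := @segment_compact R 0 1.
  apply: (nc X (nbhs x) (fun y t => U (t, y))).
  move=> t t01.
  have : nbhs ((t, x) : R^o * X) U by apply: FU; left; right.
  by apply: filterS => -[].
(* Normality leaves room for a closure inside [W]: the pieces of a categorical cover have to be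
   closed. *)
have [B CB BW] := pseudometric_normal cC CW.
exists B; split => //; exists g; split.
- apply: continuous_subspaceW gc => -[t x] [/= t01 [_ /BW]]; exact.
- by move=> t u t01 [_ /BW Wu]; apply: gN; exists (t, u) => //; exact: Wu.
(* [F] contains both end slices over all of [K], so [g] starts at the identity and ends at [p] even
   at points outside [C]. *)
- move=> u [Ku _]; rewrite gf; last by left; left.
  by rewrite /f eqxx.
- move=> u v [Ku _] [Kv _]; rewrite !gf; try by right.
  by rewrite /f /= oner_eq0 eqxx.
Qed.

(** Concatenation: [phi] is run at double speed on the first half of the interval, then the
    contraction of [D] is applied to its endpoint. *)
Lemma contractible_in_homotopic N E D (phi : R * X -> X) :
  closed E -> {within `[0, 1]%classic `*` E, continuous phi} ->
  (forall t u, `[0, 1]%classic t -> E u -> N (phi (t, u))) ->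
  (forall u, E u -> phi (0, u) = u) -> (forall u, E u -> D (phi (1, u))) ->
  contractible_in N D -> contractible_in N E.
Proof.
move=> cE pc pN p0 p1 [h [hc hN h0 h1]].
pose H (q : R * X) := if q.1 <= 2^-1 then phi (2 * q.1, q.2)
  else h (2 * q.1 - 1, phi (1, q.2)).
(* Two closed halves, so that continuity of [H] can be checked on each one separately. *)
have e01 : `[0, 1]%classic =
    (`[0, 2^-1]%classic `|` `[2^-1, 1]%classic : set R).
  apply/seteqP; split=> t /=; rewrite !in_itv /=.
    by move=> /andP[t0 t1]; case: (leP t 2^-1) => ?; [left|right]; lra.
  by move=> []; lra.
have XX : (`[0, 2^-1]%classic `|` `[2^-1, 1]%classic : set R) `*` E =
    `[0, 2^-1]%classic `*` E `|` `[2^-1, 1]%classic `*` E.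
  by apply/seteqP; split=> -[t x] /=; tauto.
exists H; split.
- rewrite e01 XX; apply: withinU_continuous.
  + by apply: closed_prod => //; exact: interval_closed.
  + by apply: closed_prod => //; exact: interval_closed.
  + apply: (within_continuous_eq (f := phi \o (fun q => (2 * q.1, q.2)))).
      by move=> [t x] [/=]; rewrite in_itv /= /H /= => /andP[_ ->].
    apply: within_continuous_comp pc.
      by move=> [t x] [/=]; rewrite !in_itv /= => tE ?; split => //; lra.
    apply: within_continuous_pair; apply: continuous_subspaceT => q.
      by apply: cvgM; [exact: cvg_cst|exact: cvg_fst].
    exact: cvg_snd.
  + apply: (within_continuous_eq (f := h \o
      (fun q => (2 * q.1 - 1, phi (1, q.2))))).
      (* At the common time 1/2 the definition of [H] selects [phi]; the second formula gives the
         same value because [h] is the identity at time 0. *)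
      move=> [t x] [/=]; rewrite in_itv /= /H /= => /andP[tE _] Ex.
      case: ifPn => // te; have -> : t = 2^-1 by lra.
      by rewrite mulfV ?pnatr_eq0// subrr h0 //; exact: p1.
    apply: within_continuous_comp hc.
      by move=> [t x] [/=]; rewrite !in_itv /= => tE ?; split; [lra|exact: p1].
    apply: within_continuous_pair.
      apply: continuous_subspaceT => q; apply: cvgB; last exact: cvg_cst.
      by apply: cvgM; [exact: cvg_cst|exact: cvg_fst].
    rewrite [X in continuous X](_ : _ = phi \o (fun q : R * X => (1, q.2)))//.
    apply: within_continuous_comp pc.
      by move=> [t x] [/= _ Ex]; rewrite in_itv /= lexx ler01.
    apply: within_continuous_pair; apply: continuous_subspaceT => q.
      exact: cvg_cst.
    exact: cvg_snd.
- move=> t u /=; rewrite in_itv /= => tE Eu; rewrite /H /=.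
  case: ifPn => te; [apply: pN|apply: hN] => //.
  + by rewrite /= in_itv /=; lra.
  + by rewrite /= in_itv /=; lra.
  + exact: p1.
- by move=> u Eu; rewrite /H /= invr_ge0 ler0n mulr0 p0.
- move=> u v Eu Ev; rewrite /H /=.
  have -> : (1 <= 2^-1 :> R) = false by apply/negP; lra.
  have -> : 2 * 1 - 1 = 1 :> R by lra.
  by apply: h1; exact: p1.
Qed.

End Contractibility.

(** * Categorical covers and the category *)

Section Category.
Context {R : realType} {X : metricType R}.
Implicit Types (N K A B C D : set X).

(** Although [N] may fail to be closed, [C] is the trace on the compact set [K] of a closed set of
    [X]. *)
Lemma closed_in_compact N K C : compact K -> K `<=` N -> C `<=` K ->
  closed_in N C -> closed C.
Proof.
move=> cK KN CK [_ /closed_subspaceP[V cV VN]].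
have -> : C = V `&` K.
  apply/seteqP; split=> x.
    by move=> Cx; split; [have [] : (V `&` N) x by rewrite VN; split => //;
      apply/KN/CK | exact: CK].
  by move=> [Vx Kx]; have [] : (C `&` N) x by rewrite -VN; split => //; exact: KN.
by apply: closedI => //; apply: compact_closed => //; exact: metric_hausdorff.
Qed.

Lemma closed_closed_in N D : D `<=` N -> closed D -> closed_in N D.
Proof. by move=> DN cD; split => //; exact: closed_subspaceW. Qed.

(** Each piece is thickened separately, so the number of pieces is kept while their union grows to a
    neighborhood of [A] relative to [K]. *)
Lemma categorical_cover_thickening N K A m : ANE N -> compact K -> K `<=` N ->
  A `<=` K -> categorical_cover N A m ->
  exists2 D : 'I_m -> set X,
    forall i, [/\ closed (D i), D i `<=` K & contractible_in N (D i)] &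
    exists2 V, set_nbhs A V & K `&` V `<=` \bigcup_i D i.
Proof.
move=> hN cK KN AK [C [hC AE]].
have CK i : C i `<=` K by apply: subset_trans AK; rewrite AE; exact: bigcup_sup.
have clK : closed K by apply: compact_closed => //; exact: metric_hausdorff.
have /choice[B hB] i : exists B : set X,
    set_nbhs (C i) B /\ contractible_in N (K `&` closure B).
  have [cCi kCi] := hC i; apply: contractible_in_thickening kCi => //.
  exact: closed_in_compact (CK i) cCi.
exists (fun i => K `&` closure (B i)).
  move=> i; split; [|by move=> x []|by have [] := hB i].
  by apply: closedI => //; exact: closed_closure.
exists (\bigcup_i B i).
  rewrite AE => x [i _ Cix]; have [/(_ _ Cix) + _] := hB i.
  by apply: filterS => y By; exists i.
by move=> x [Kx [i _ Bx]]; exists i => //; split => //; exact: subset_closure.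
Qed.

Lemma ls_category_ge0 N A : (0 <= ls_category N A)%E.
Proof. by apply: le_ereal_inf_tmp => _ [m _ <-]; rewrite lee_fin. Qed.

Lemma ls_category_le N A m : categorical_cover N A m ->
  (ls_category N A <= m%:R%:E)%E.
Proof. by move=> Am; apply: ereal_inf_lbound; exists m. Qed.

(** A nonempty set of naturals has a least element; this reduces inequalities between categories to
    constructions of covers. *)
Lemma ls_category_attained N A : ls_category N A != +oo%E ->
  exists2 m, categorical_cover N A m & ls_category N A = m%:R%:E.
Proof.
move=> fin.
have ex : exists m, `[< categorical_cover N A m >].
  apply: contrapT => noex; move/eqP: fin; apply.
  rewrite /ls_category [X in ereal_inf X](_ : _ = set0) ?ereal_inf0//.
  by rewrite -subset0 => x [m Am _]; apply: noex; exists m; apply/asboolP.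
have [m /asboolP Am mmin] := ex_minnP ex; exists m => //.
apply/eqP; rewrite eq_le ls_category_le//=.
apply: le_ereal_inf_tmp => _ [k Ak <-].
by rewrite lee_fin ler_nat mmin//; apply/asboolP.
Qed.

Lemma ls_category0 N : ls_category N set0 = 0%E.
Proof.
apply/eqP; rewrite eq_le ls_category_ge0 andbT; apply: (@ls_category_le _ _ 0%N).
exists (fun=> set0); split; first by case.
by apply/esym; rewrite -subset0 => x [[]].
Qed.

End Category.

(** * The flow on a compact invariant set and the step between attractors *)

Section Semiflow.
Context {R : realType} {X : metricType R} (Phi : local_semiflow X).
Implicit Types (N K A B D : set X).

Lemma flow_within_continuous K : invariant_set Phi K ->
  {within `[0, +oo[%classic `*` K, continuous (fun p => Phi p.1 p.2)}.
Proof.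
move=> [Koo _]; apply: continuous_subspaceW (@flow_continuous _ _ Phi).
by move=> [t x] [/=]; rewrite in_itv /= andbT => t0 Kx; split; rewrite //= Koo ?ltry.
Qed.

Lemma flow_invariant K t x : invariant_set Phi K -> 0 <= t -> K x -> K (Phi t x).
Proof. by move=> [_ KE] t0 Kx; rewrite -(KE t t0); exists x. Qed.

Lemma flow_time_within_continuous K t : invariant_set Phi K -> 0 <= t ->
  {within K, continuous (Phi t)}.
Proof.
move=> KI t0.
rewrite [X in continuous X](_ : _ = (fun p => Phi p.1 p.2) \o pair t)//.
apply: within_continuous_comp (flow_within_continuous KI).
  by move=> x Kx; split => //=; rewrite in_itv /= t0.
apply: within_continuous_pair; apply: continuous_subspaceT => q.
  exact: cvg_cst.
exact: cvg_id.
Qed.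

(** The homotopy sending [(s, x)] to [Phi (s * t) x] stays in [K], hence in [N], and ends in [D]. *)
Lemma contractible_in_flow_preimage N K D t : compact K -> invariant_set Phi K ->
  K `<=` N -> 0 <= t -> closed D -> contractible_in N D ->
  closed (K `&` Phi t @^-1` D) /\ contractible_in N (K `&` Phi t @^-1` D).
Proof.
move=> cK KI KN t0 cD kD.
have cE : closed (K `&` Phi t @^-1` D).
  apply: closed_preimage_within => //.
    by apply: compact_closed => //; exact: metric_hausdorff.
  exact: flow_time_within_continuous KI t0.
split=> //.
apply: (@contractible_in_homotopic _ _ _ _ D
  ((fun p => Phi p.1 p.2) \o (fun p : R * X => (p.1 * t, p.2)))) kD => //.
- apply: within_continuous_comp (flow_within_continuous KI).
    move=> [s x] [/=]; rewrite !in_itv /= andbT => /andP[s0 _] [Kx _].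
    by split => //; exact: mulr_ge0.
  apply: within_continuous_pair; apply: continuous_subspaceT => q.
    by apply: cvgM; [exact: cvg_fst|exact: cvg_cst].
  exact: cvg_snd.
- move=> s x /=; rewrite in_itv /= => /andP[s0 _] [Kx _]; apply: KN.
  by apply: flow_invariant => //; exact: mulr_ge0.
- by move=> x _; rewrite /= mul0r flow0.
- by move=> x [_ Dx]; rewrite /= mul1r.
Qed.

Lemma nbhd_in_setI K A V : A `<=` K -> set_nbhs A V -> nbhd_in K A (K `&` V).
Proof.
move=> AK AV; split=> [x []//|x Ax].
rewrite /nbhs /= -nbhs_subspace_in; last exact: AK.
by apply: filterS (AV x Ax) => y Vy Ky.
Qed.

(** The orbit of [x] enters the attracted neighborhood at some time; by continuity so do the nearby
    orbits in [K], which are then driven into [V] uniformly. The joint filter in [y] and [t] is the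
    form that a compactness argument consumes. *)
Lemma attraction_basin_near K A U V x : invariant_set Phi K -> A `<=` K ->
  nbhd_in K A U -> attracts Phi K A U -> set_nbhs A V ->
  attraction_basin Phi K A x ->
  \forall y \near x & t \near +oo, K y -> V (Phi t y).
Proof.
move=> KI AK [_ AU] [_ Uatt] AV [Kx [_ xatt]].
(* [U] is a neighborhood only relative to [K]; [W] is an open set of [X] whose trace on [K] lies in
   [U]. *)
have [W [oW AW WU]] : exists W, [/\ open W, A `<=` W & K `&` W `<=` U].
  exists [set y | K y -> U y]°; split; first exact: open_interior.
    move=> a Aa; have := AU a Aa.
    by rewrite /nbhs /= -nbhs_subspace_in //; exact: AK.
  by move=> y [Ky /interior_subset]; apply.
have nAW : set_nbhs A W by apply/set_nbhsP; exists W; split.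
have [T T0 xT] := xatt _ (nbhd_in_setI AK nAW).
have [T' T'0 UT'] := Uatt _ (nbhd_in_setI AK AV).
(* Attraction speaks of times strictly beyond [T]; [T + 1] is one such time. *)
have sT : T < T + 1 by rewrite ltrDl.
have s0 : 0 <= T + 1 by rewrite addr_ge0// ltW.
have [Ks Ws] : (K `&` W) (Phi (T + 1) x) by apply: (xT _ sT); exists x.
have nx : \forall y \near x, K y -> W (Phi (T + 1) y).
  have /subspace_continuousP/(_ x Kx) := flow_time_within_continuous KI s0.
  apply; exact: open_nbhs_nbhs.
(* Time [T + 1] is spent reaching [W], and more than [T'] is then left to go from [U] into [V]. *)
exists ([set y | K y -> W (Phi (T + 1) y)], [set t | T' + (T + 1) < t]).
  by split => //=; exists (T' + (T + 1)); split => //; exact: num_real.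
move=> [y t] [/= Wy tT] Ky.
have [KK _] := KI.
have tE : t = (t - (T + 1)) + (T + 1) by rewrite subrK.
rewrite tE; have [| | |_ ->] := @flowD _ _ Phi (t - (T + 1)) (T + 1) y => //.
- by rewrite subr_ge0; apply: ltW; apply: lt_trans tT; rewrite ltrDr.
- by rewrite KK // ltry.
have [] : (K `&` V) (Phi (t - (T + 1)) (Phi (T + 1) y)); last by [].
apply: (UT' (t - (T + 1))); first by rewrite ltrBrDr.
exists (Phi (T + 1) y) => //; apply: WU; split; last exact: Wy.
exact: flow_invariant.
Qed.

(** Asking only for an attracted neighborhood of [A] lets the empty set at the bottom of the
    filtration be treated like the attractors. *)
Lemma categorical_cover_attractor_step N K A B p q :
  ANE N -> compact K -> invariant_set Phi K -> K `<=` N ->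
  A `<=` K -> B `<=` K -> compact B ->
  (exists2 U, nbhd_in K A U & attracts Phi K A U) ->
  categorical_cover N A p ->
  categorical_cover N (B `\` attraction_basin Phi K A) q ->
  categorical_cover N B (q + p).
Proof.
move=> hN cK KI KN AK BK cB [U AU attU] hA hM.
have clB : closed B by apply: compact_closed => //; exact: metric_hausdorff.
have [D hD [V AV VD]] := categorical_cover_thickening hN cK KN AK hA.
have MK : B `\` attraction_basin Phi K A `<=` K by move=> x [/BK].
have [D' hD' [V' /set_nbhsP[W [oW MW WV']] VD']] :=
  categorical_cover_thickening hN cK KN MK hM.
have cQ : compact (B `\` W).
  by apply: compact_closedI => //; exact: open_closedC.
have /compact_near_coveringP nQ := cQ.
(* Points of [B] outside [W] are in the basin of [A]; compactness makes their entrance times into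
   [V] uniform. *)
have : \forall t \near +oo, B `\` W `<=` (fun x => K x -> V (Phi t x)).
  apply: nQ => x [Bx nWx].
  apply: (attraction_basin_near KI AK AU attU AV).
  by apply: contrapT => nx; apply: nWx; exact: MW.
move=> /(filterI (nbhs_pinfty_ge (num_real 0))) /filter_ex[t [/= t0 QV]].
(* The first [q] pieces cover the part of [B] in [W], the last [p] the part outside. Intersecting
   with [B] makes the union exactly [B]. *)
exists (fun i : 'I_(q + p) => match fintype.split i with
  | inl j => B `&` D' j
  | inr j => B `&` (K `&` Phi t @^-1` D j) end); split.
  move=> i; case: (fintype.split i) => j.
    have [cDj _ kDj] := hD' j; split; last exact: contractible_in_sub kDj.
    by apply: closed_closed_in; [move=> x [/BK/KN]|exact: closedI].
  have [cDj _ kDj] := hD j.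
  have [cE kE] := contractible_in_flow_preimage cK KI KN t0 cDj kDj.
  split; last exact: contractible_in_sub kE.
  by apply: closed_closed_in; [move=> x [/BK/KN]|exact: closedI].
apply/seteqP; split=> x; last by move=> [i _]; case: (fintype.split i) => j [].
move=> Bx; have Kx := BK x Bx; have [Wx|nWx] := pselect (W x).
  have [j _ Dx] := VD' x (conj Kx (WV' x Wx)).
  by exists (lshift p j) => //; rewrite (unsplitK (inl j)).
have Kt := flow_invariant KI t0 Kx.
have [j _ Dx] := VD _ (conj Kt (QV x (conj Bx nWx) Kx)).
by exists (rshift q j) => //; rewrite (unsplitK (inr j)).
Qed.

Lemma ls_category_attractor_step N K A B :
  ANE N -> compact K -> invariant_set Phi K -> K `<=` N ->
  A `<=` K -> B `<=` K -> compact B ->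
  (exists2 U, nbhd_in K A U & attracts Phi K A U) ->
  (ls_category N B <=
    ls_category N A + ls_category N (B `\` attraction_basin Phi K A))%E.
Proof.
move=> hN cK KI KN AK BK cB hU.
(* Categories are nonnegative, so an infinite summand makes the sum [+oo]. *)
have [->|/ls_category_attained[p hp ->]] := eqVneq (ls_category N A) +oo%E.
  rewrite addye ?leey// gt_eqF//.
  by apply: lt_le_trans (ls_category_ge0 _ _); rewrite ltNyr.
have [->|/ls_category_attained[q hq ->]] :=
  eqVneq (ls_category N (B `\` attraction_basin Phi K A)) +oo%E.
  by rewrite addey ?leey.
rewrite -EFinD -natrD addnC; apply: ls_category_le.
exact: categorical_cover_attractor_step hU hp hq.
Qed.

End Semiflow.

(** * Summation along the filtration by attractors *)

Theorem theorem4p4 (R : realType) (X : metricType R)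
    (hX : complete_space X) (Phi : local_semiflow X)
    (K : set X) (hKc : compact K) (hKi : invariant_set Phi K)
    (n : nat) (M : 'I_n -> set X) (hM : morse_decomposition Phi K M)
    (N : set X) (hN : ANE N) (hKN : K `<=` N) :
  (ls_category N K <= \sum_(i < n) ls_category N (M i))%E.
Proof.
have [A [A0 An _ attrA ME]] := hM.
under eq_bigr do rewrite ME.
rewrite -(big_mkord xpredT (fun k => ls_category N
  (A k.+1 `\` attraction_basin Phi K (A k)))) -{1}An.
(* Only the upper index is generalized: the induction bounds the category of [A k] by the first [k]
   terms, for [k] at most [n]. *)
elim: {-2}n (leqnn n) => [_|k IH kn]; first by rewrite big_geq// A0 ls_category0.
rewrite big_nat_recr//=; apply: le_trans (leeD2r _ (IH (ltnW kn))).
have [_ cAk1 _ Ak1K _] := attrA k.+1 kn.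
(* [A 0] is empty and not an attractor; the empty set serves as its own neighborhood and is
   attracted vacuously, so the time 1 is arbitrary. *)
have [kE|k0] := posnP k.
  have -> : A k = set0 by rewrite kE.
  apply: ls_category_attractor_step => //.
  exists set0; first by split=> [x []|x []].
  by split=> [x []|U _]; exists 1 => // t _ _ [x []].
have [_ _ _ AkK [U [AU attU _]]] : is_attractor Phi K (A k).
  by apply: attrA; rewrite k0 ltnW.
by apply: ls_category_attractor_step => //; exists U.
Qed.
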